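(* Let $P^2$ be the square grid. Then $\mathsf{wCop}(P^2)=\infty$.
   Context: The square grid is the graph arising as the regular tiling of the Euclidean plane by squares: vertex set $\mathbb{Z}^2$, with two vertices adjacent if they differ by exactly $1$ in one coordinate and agree in the other. For a connected graph $\Gamma$, $\mathsf{dist}$ is the path distance on $V(\Gamma)$. Game. The cops and robber game on a connected graph $\Gamma$ has parameters: number of cops $n$, cop speed $\sigma$, cop reach $\rho$, robber speed $\psi$, a vertex $v$, and a positive integer $R$. It is a perfect information game. First the $n$ cops choose initial vertices $c^1_0,\dots,c^n_0$; then, knowing these, the robber chooses an initial vertex $r_0$. In stage $k\ge 1$ each cop moves from $c^i_{k-1}$ to a vertex $c^i_k$ with $\mathsf{dist}(c^i_{k-1},c^i_k)\le\sigma$. The robber is captured during stage $k$ if $\mathsf{dist}(r_{k-1},c^i_k)\le\rho$ for some $i$. If not captured, the robber moves from $r_{k-1}$ to a vertex $r_k$ such that there is a path from $r_{k-1}$ to $r_k$ of length at most $\psi$ all of whose vertices are at distance larger than $\rho$ from every $c^i_k$. The cops win (protect the $R$-ball centered at $v$) if the robber is captured at some stage or there is $N>0$ such that $\mathsf{dist}(v,r_k)>R$ for all $k\ge N$. $\Gamma$ is $\mathsf{CopWin}(n,\sigma,\rho,\psi,R)$ if for every vertex $v$ of $\Gamma$ the $n$ cops have a winning strategy in the game with parameters $n,\sigma,\rho,\psi,v,R$. $\Gamma$ is $n$-weak cop win if $\exists\,\sigma\in\mathbb{Z}_{>0}\ \exists\,\rho\in\mathbb{Z}_{\ge0}\ \forall\,\psi,R\in\mathbb{Z}_{>0}$: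 $\Gamma$ is $\mathsf{CopWin}(n,\sigma,\rho,\psi,R)$. The weak cop number $\mathsf{wCop}(\Gamma)\in\mathbb{Z}_{>0}\cup\{\infty\}$ is the smallest positive integer $n$ such that $\Gamma$ is $n$-weak cop win, and $\infty$ if there is none. *)

(* Defs.v *)
From mathcomp Require Import all_boot all_order all_algebra zify.
From mathcomp Require Import boolp constructive_ereal.

Set Implicit Arguments.
Unset Strict Implicit.
Unset Printing Implicit Defensive.

Import Order.TTheory GRing.Theory Num.Theory.

Definition is_walk (V : eqType) (e : rel V) (x : V) (p : seq V) (y : V) : bool :=
  path e x p && (last x p == y).

Record connected_graph := ConnectedGraph {
  vertex :> eqType;
  adj : rel vertex;
  adj_sym : symmetric adj;
  adj_irr : irreflexive adj;
  adj_connected : forall x y, exists p, is_walk adj x p y }.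

(* The walk [x :: p] has [size p] edges. *)
Definition walk_of_length (G : connected_graph) (x y : G) (d : nat) : Prop :=
  exists2 p : seq G, is_walk (@adj G) x p y & size p = d.

Lemma walk_of_length_ex (G : connected_graph) (x y : G) :
  exists d, `[< walk_of_length x y d >].
Proof.
by have [p xpy] := adj_connected x y; exists (size p); apply/asboolP; exists p.
Qed.

Definition dist (G : connected_graph) (x y : G) : nat :=
  ex_minn (walk_of_length_ex x y).

(* Entry [k] of a history is the pair (cops' positions, robber's position) at
   the end of stage [k], stage 0 being the choice of the initial positions. *)
Definition history (G : connected_graph) (n : nat) : Type :=
  seq ({ffun 'I_n -> G} * G).

Record cop_strategy (G : connected_graph) (n : nat) := CopStrategy {
  cop_init : {ffun 'I_n -> G};
  cop_move : history G n -> {ffun 'I_n -> G} }.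

(* Legality is asked after every history, even one that the strategy never
   reaches; this costs nothing, as the cops may always stay where they are. *)
Definition legal_strategy (G : connected_graph) (n sigma : nat)
    (S : cop_strategy G n) : Prop :=
  forall (h : history G n) (c : {ffun 'I_n -> G}) (r : G) (i : 'I_n),
    dist (c i) (cop_move S (rcons h (c, r)) i) <= sigma.

Definition follows (G : connected_graph) (n : nat) (S : cop_strategy G n)
    (c : nat -> {ffun 'I_n -> G}) (r : nat -> G) : Prop :=
  c 0 = cop_init S /\
  forall k, c k.+1 = cop_move S (mkseq (fun j => (c j, r j)) k.+1).

(* Capture during stage [k.+1]. *)
Definition captured (G : connected_graph) (n rho : nat)
    (c : nat -> {ffun 'I_n -> G}) (r : nat -> G) (k : nat) : Prop :=
  exists i : 'I_n, dist (r k) (c k.+1 i) <= rho.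

(* The robber's move of stage [k.+1]; both endpoints of the walk are
   constrained. *)
Definition robber_move (G : connected_graph) (n rho psi : nat)
    (c : nat -> {ffun 'I_n -> G}) (r : nat -> G) (k : nat) : Prop :=
  exists p : seq G,
    [/\ is_walk (@adj G) (r k) p (r k.+1),
        size p <= psi
      & forall x, x \in r k :: p -> forall i, rho < dist x (c k.+1 i)].

(* A play that ends by a capture is continued arbitrarily to an infinite one:
   the robber's moves are constrained only as long as he is not captured. *)
Definition legal_robber (G : connected_graph) (n rho psi : nat)
    (c : nat -> {ffun 'I_n -> G}) (r : nat -> G) : Prop :=
  forall k, (forall j, j <= k -> ~ captured rho c r j) ->
    robber_move rho psi c r k.

Definition cops_win (G : connected_graph) (n rho : nat) (v : G) (R : nat)
    (c : nat -> {ffun 'I_n -> G}) (r : nat -> G) : Prop :=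
  (exists k, captured rho c r k) \/
  (exists2 N, 0 < N & forall k, N <= k -> R < dist v (r k)).

Definition winning_strategy (G : connected_graph) (n sigma rho psi : nat)
    (v : G) (R : nat) (S : cop_strategy G n) : Prop :=
  legal_strategy sigma S /\
  forall (c : nat -> {ffun 'I_n -> G}) (r : nat -> G),
    follows S c r -> legal_robber rho psi c r -> cops_win rho v R c r.

Definition CopWin (G : connected_graph) (n sigma rho psi R : nat) : Prop :=
  forall v : G, exists S : cop_strategy G n,
    winning_strategy sigma rho psi v R S.

Definition weak_cop_win (G : connected_graph) (n : nat) : Prop :=
  exists sigma rho, 0 < sigma /\
    forall psi R, 0 < psi -> 0 < R -> CopWin G n sigma rho psi R.

Definition wCop (G : connected_graph) : \bar nat :=
  match pselect (exists n, (0 < n) && `[< weak_cop_win G n >]) with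
  | left ex_n => (ex_minn ex_n)%:E
  | right _ => +oo%E
  end.

Local Open Scope ring_scope.

Definition grid_adj : rel (int * int) := fun x y =>
  (`|x.1 - y.1| == 1) && (x.2 == y.2) || (x.1 == y.1) && (`|x.2 - y.2| == 1).

Lemma grid_adj_sym : symmetric grid_adj.
Proof.
by move=> x y; rewrite /grid_adj distrC (distrC x.2) (eq_sym x.1) (eq_sym x.2).
Qed.

Lemma grid_adj_irr : irreflexive grid_adj.
Proof. by move=> x; rewrite /grid_adj !subrr normr0 andbF. Qed.

Lemma grid_adj_connected (x y : int * int) : exists p, is_walk grid_adj x p y.
Proof.
have [m] := ubnP (`|x.1 - y.1| + `|x.2 - y.2|)%N.
elim: m x => // m IHm [a b]; case: y IHm => c d IHm /= lt_m.
have step z : grid_adj (a, b) z -> (`|z.1 - c| + `|z.2 - d| < m)%N ->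
    exists p, is_walk grid_adj (a, b) p (c, d).
  move=> az /IHm[p /andP[zp lastp]]; exists (z :: p).
  by rewrite /is_walk /= az zp.
case: (ltgtP a c) => [lt_ac|lt_ca|eq_ac].
- by apply: (step (a + 1, b)); rewrite /grid_adj /=; lia.
- by apply: (step (a - 1, b)); rewrite /grid_adj /=; lia.
case: (ltgtP b d) => [lt_bd|lt_db|eq_bd].
- by apply: (step (a, b + 1)); rewrite /grid_adj /=; lia.
- by apply: (step (a, b - 1)); rewrite /grid_adj /=; lia.
by exists [::]; rewrite /is_walk /= eq_ac eq_bd.
Qed.

Definition square_grid : connected_graph :=
  ConnectedGraph grid_adj_sym grid_adj_irr grid_adj_connected.

(* Main.v *)
Require Import Defs.
From mathcomp Require Import all_boot all_order all_algebra.
From mathcomp Require Import boolp constructive_ereal.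
From mathcomp Require Import zify.

(** Whatever the number [n] of cops, their speed [sigma] and their reach [rho],
    the robber survives for ever inside a box of side
    [L = n * (2 * (rho + sigma) + 1)], provided that his speed is at least the
    length [2 * L] of an L-shaped route across that box.

    Call a line of the grid clear if it is at distance more than [rho + sigma]
    from every cop. A cop spoils at most one of any family of parallel lines
    spaced by [2 * (rho + sigma) + 1], so [n] cops leave clear one of [n + 1]
    such columns, and one of [n + 1] such rows ([far_from_finite_family]). The
    robber always stands at the intersection of a clear column and a clear row.
    When the cops move, they come nearer to the old row by at most [sigma], so
    that this row remains out of their reach: the robber runs along it to a
    column that is clear for their new positions, and along that column to a
    row that is clear for them ([safe_walk]). He is never captured and never
    leaves the box.

    His rule depends on the cops' current positions only, so it can be played
    against any strategy ([play_against]). *)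

Set Implicit Arguments.
Unset Strict Implicit.
Unset Printing Implicit Defensive.

Import Order.TTheory GRing.Theory Num.Theory.

Lemma dist_le_size_walk (G : connected_graph) (x y : G) (p : seq G) :
  is_walk (@adj G) x p y -> dist x y <= size p.
Proof.
move=> xpy; rewrite /dist; case: ex_minnP => d _; apply.
by apply/asboolP; exists p.
Qed.

(** This holds because each coordinate changes by at most one along an edge. *)
Lemma coord_le_dist (x y : square_grid) :
  `|(x.1 - y.1)%R| <= dist x y /\ `|(x.2 - y.2)%R| <= dist x y.
Proof.
rewrite /dist; case: ex_minnP => d /asboolP[p /andP[xp /eqP <-] <-] _.
elim: p x xp => [|[a' b'] p IHp] [a b] /=; first by rewrite !subrr.
(* [lia] recognizes the coordinates only at the type [int] itself. *)
change int in a, b, a', b'; case/andP=> + /IHp.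
by rewrite /grid_adj /=; lia.
Qed.

Lemma int_segment (a b : int) :
  exists p, is_walk (fun x y : int => `|(x - y)%R| == 1) a p b
            /\ size p = `|(a - b)%R|.
Proof.
move Em: `|(a - b)%R| => m; elim: m a Em => [|m IHm] a Em.
  by exists [::]; rewrite /is_walk /=; split=> //; apply/eqP; lia.
have [a' [aa' Em']] : exists a', `|(a - a')%R| == 1 /\ `|(a' - b)%R| = m.
  by case: (leP a b) => ?; [exists (a + 1)%R | exists (a - 1)%R]; lia.
have [p [/andP[pa pb] sz_p]] := IHm a' Em'.
by exists (a' :: p); rewrite /is_walk /= aa' pa pb sz_p.
Qed.

(** This is [int_segment] transported by the embeddings [x |-> (x, y)] and
    [y |-> (x, y)], which preserve adjacency. *)
Lemma grid_L_walk (x y : square_grid) :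
  exists p : seq square_grid,
    [/\ is_walk (@adj square_grid) x p y,
        size p = `|(x.1 - y.1)%R| + `|(x.2 - y.2)%R|
      & forall z, z \in x :: p -> z.2 = x.2 \/ z.1 = y.1].
Proof.
case: x y => [a b] [a' b'] /=.
have [p [/andP[pa /eqP pl] sz_p]] := int_segment a a'.
have [q [/andP[qa /eqP ql] sz_q]] := int_segment b b'.
exists ([seq (x, b) | x <- p] ++ [seq (a', y) | y <- q]); split.
- apply/andP; split; last first.
    by rewrite last_cat (last_map (fun x => (x, b))) pl
               (last_map (fun y => (a', y))) ql.
  rewrite cat_path (last_map (fun x => (x, b))) pl !path_map.
  apply/andP; split; [move: pa | move: qa];
    by apply: sub_path => u w; rewrite /= /grid_adj /=; lia.
- by rewrite size_cat !size_map sz_p sz_q.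
- move=> z; rewrite inE mem_cat => /or3P[/eqP-> | /mapP[u _ ->] | /mapP[u _ ->]].
  + by left.
  + by left.
  + by right.
Qed.

(** The candidates are the [n + 1] multiples [j * (2 * m + 1)], [j <= n]: they
    are more than [2 * m] apart, so that each [z i] is within [m] of at most
    one of them, and the pigeonhole principle applies. *)
Lemma far_from_finite_family (n m : nat) (z : 'I_n -> int) :
  exists2 t : nat, t <= n * (2 * m + 1) &
    forall i, m < `|(t%:Z - z i)%R|.
Proof.
apply: contrapT => no_t.
have near (j : 'I_n.+1) : exists i, `|((j * (2 * m + 1))%:Z - z i)%R| <= m.
  apply: contrapT => no_i; apply: no_t; exists (j * (2 * m + 1)).
    by rewrite leq_mul2r -ltnS ltn_ord orbT.
  by move=> i; rewrite ltnNge; apply/negP => le_m; apply: no_i; exists i.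
have [f fP] := choice near.
have f_inj : injective f.
  move=> j k eq_f; apply: val_inj => /=.
  by have := fP j; have := fP k; rewrite eq_f; nia.
by have := leq_card f f_inj; rewrite !card_ord ltnn.
Qed.

(** Lower bounds on coordinates, rather than on [dist], because they pass from
    [r] to every vertex that shares a row or a column with it. *)
Definition safe (n m : nat) (c : 'I_n -> square_grid) (r : square_grid) : Prop :=
  forall i, m < `|(r.1 - (c i).1)%R| /\ m < `|(r.2 - (c i).2)%R|.

Definition in_box (L : nat) (r : square_grid) : Prop :=
  (0 <= r.1 <= L%:Z)%R /\ (0 <= r.2 <= L%:Z)%R.

Lemma safe_in_box (n m : nat) (c : 'I_n -> square_grid) :
  exists r, safe m c r /\ in_box (n * (2 * m + 1)) r.
Proof.
have [x le_x xP] := far_from_finite_family m (fun i => (c i).1).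
have [y le_y yP] := far_from_finite_family m (fun i => (c i).2).
by exists (x%:Z, y%:Z)%R; split; [split | rewrite /in_box /=; lia].
Qed.

Lemma safe_not_captured (n sigma rho : nat) (c c' : 'I_n -> square_grid)
    (r : square_grid) (i : 'I_n) :
  dist (c i) (c' i) <= sigma -> safe (rho + sigma) c r -> rho < dist r (c' i).
Proof.
move=> cc' /(_ i)[safe1 _].
by have [] := coord_le_dist r (c' i); have [] := coord_le_dist (c i) (c' i); lia.
Qed.

(** The route follows the old row, which had a margin of [sigma] and so is
    still out of reach, and then the new column. *)
Lemma safe_walk (n sigma rho L : nat) (c c' : 'I_n -> square_grid)
    (r r' : square_grid) :
  (forall i, dist (c i) (c' i) <= sigma) ->
  safe (rho + sigma) c r -> safe (rho + sigma) c' r' ->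
  in_box L r -> in_box L r' ->
  exists p : seq square_grid,
    [/\ is_walk (@adj square_grid) r p r', size p <= 2 * L
      & forall x, x \in r :: p -> forall i, rho < dist x (c' i)].
Proof.
move=> cc' safe_r safe_r' box_r box_r'.
have [p [rpr' sz_p on_p]] := grid_L_walk r r'; exists p; split=> //.
  by move: box_r box_r'; rewrite /in_box sz_p; lia.
move=> x /on_p x_on i; move: (cc' i) (safe_r i) (safe_r' i) => cc'i.
have [_] := coord_le_dist (c i) (c' i); have [] := coord_le_dist x (c' i).
by case: x_on => ->; lia.
Qed.

(** A rule for the robber that looks at the cops' positions only determines,
    with a strategy of the cops, a whole play. As a strategy reads the entire
    history, it is histories that are built by recursion, and the cops'
    positions are then read off them. *)
Lemma play_against (G : connected_graph) (n : nat) (S : cop_strategy G n)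
    (f : {ffun 'I_n -> G} -> G) :
  exists c : nat -> {ffun 'I_n -> G}, follows S c (fun k => f (c k)).
Proof.
pose entry c := (c, f c).
pose h := fix h k :=
  if k is k'.+1 then rcons (h k') (entry (cop_move S (h k')))
  else [:: entry (cop_init S)].
pose c k := if k is k'.+1 then cop_move S (h k') else cop_init S.
have hE k : h k = mkseq (fun j => (c j, f (c j))) k.+1.
  by elim: k => [//|k IHk]; rewrite mkseqS -IHk.
by exists c; split=> // k; rewrite -hE.
Qed.

Lemma follows_legal (G : connected_graph) (n sigma : nat) (S : cop_strategy G n)
    (c : nat -> {ffun 'I_n -> G}) (r : nat -> G) :
  legal_strategy sigma S -> follows S c r ->
  forall k i, dist (c k i) (c k.+1 i) <= sigma.
Proof.
move=> legalS [_ cS] k i; rewrite cS mkseqS; exact: legalS.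
Qed.

Lemma grid_not_weak_cop_win (n : nat) : ~ weak_cop_win square_grid n.
Proof.
case=> sigma [rho [_ win]].
pose m := rho + sigma; pose L := n * (2 * m + 1).
(* The successor makes both parameters positive when there is no cop. *)
have [//|//|S [legalS winS]] := win (2 * L).+1 (2 * L).+1 _ _ (0%R, 0%R).
have [f fP] := choice (fun c : {ffun 'I_n -> square_grid} => safe_in_box m c).
have [c follows_c] := play_against S f.
have speed := follows_legal legalS follows_c.
case: (winS _ _ follows_c).
- move=> k _.
  have [safe_k box_k] := fP (c k); have [safe_k1 box_k1] := fP (c k.+1).
  have [p [walk_p sz_p far_p]] := safe_walk (speed k) safe_k safe_k1 box_k box_k1.
  by exists p; split=> //; apply: leqW.
- case=> k [i]; rewrite leqNgt => /negP; apply.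
  by have [safe_k _] := fP (c k); apply: safe_not_captured safe_k.
- case=> N _ /(_ N (leqnn N)).
  have [_ box_N] := fP (c N).
  have [p [walk_p sz_p _]] := grid_L_walk (0%R, 0%R) (f (c N)).
  by move: (dist_le_size_walk walk_p) box_N; rewrite sz_p /in_box /=; lia.
Qed.

Theorem theorem3 : wCop square_grid = +oo%E.
Proof.
rewrite /wCop; case: pselect => // ex_n; exfalso.
by case: ex_n => n /andP[_ /asboolP] /grid_not_weak_cop_win.
Qed.
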